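(* Let $\mathbf{A}$ be a perfect pseudo MV-algebra, $\mathbf{B}$ a B-cycle and $\mathbf{L}$ an $\ell$-group. Then for any homomorphism $f\colon\mathbf{A}\to\mathcal{K}_{\mathbf{B}}(\mathbf{L})$ there exists a unique homomorphism of B-cycles $g\colon\mathbf{B}\to[\mathbf{A},\mathbf{L}]$ such that $\mathcal{K}_g(\mathbf{L})\circ\eta_{\mathbf{A}}=f$. Moreover, $g=[f,\mathbf{L}]\circ\varepsilon_{\mathbf{B}}$ holds.
   Context: A residuated lattice is an algebra $(A;\wedge,\vee,\cdot,\backslash,/,1)$ that is a lattice and a monoid with $y\le x\backslash z\iff xy\le z\iff x\le z/y$. An FL$_w$-algebra is a residuated lattice with an additional constant $0$ such that $1$ is the greatest and $0$ the least element; $x^-:=0/x$, $x^{\sim}:=x\backslash 0$. A pseudo MV-algebra is an FL$_w$-algebra satisfying $x/(y\backslash x)=x\vee y=(x/y)\backslash x$. An FL$_w$-algebra $\mathbf{A}$ is perfect if there is a homomorphism $h_{\mathbf{A}}\colon\mathbf{A}\to\mathbf{2}$ to the two-element Boolean algebra such that $x\le y$ whenever $h_{\mathbf{A}}(x)=0$, $h_{\mathbf{A}}(y)=1$ (such $h_{\mathbf A}$ is unique); $F_{\mathbf{A}}=h_{\mathbf{A}}^{-1}(1)$, $J_{\mathbf{A}}=h_{\mathbf{A}}^{-1}(0)$, and $\mathbf{F}_{\mathbf{A}}$ is the corresponding subalgebra of the $0$-free (residuated lattice) reduct of $\mathbf{A}$. For an $\ell$-group $\mathbf{L}$ with unit $e$,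 $L^-=\{x\le e\}$, $L^+=\{x\ge e\}$, and $\mathbf{L}^-$ is the residuated lattice on $L^-$ with $\wedge,\vee,\cdot,e$ inherited and $x/y:=xy^{-1}\wedge e$, $y\backslash x:=y^{-1}x\wedge e$. For an automorphism $\lambda$ of $\mathbf{L}$, $\mathcal{K}(\mathbf{L},\lambda)=(L^-\uplus L^+;\wedge,\vee,\odot,\backslash,/,0,1)$ is the perfect pseudo MV-algebra in which $0:=e\in L^+$, $1:=e\in L^-$, $L^+$ lies entirely below $L^-$, lattice operations within $L^-$ and within $L^+$ are those of $\mathbf{L}$, and $x\odot y$ is: $xy\in L^-$ if $x,y\in L^-$; $\lambda(x)y\vee e\in L^+$ if $x\in L^-,y\in L^+$; $xy\vee e\in L^+$ if $x\in L^+,y\in L^-$; $e\in L^+$ if $x,y\in L^+$ (the residuals are determined by $\odot$ and the order). A B-cycle is a pair $\mathbf{B}=(B;\beta)$ with $\beta$ a bijection on $B$; homomorphisms of B-cycles are maps commuting with the bijections. The kite over $\mathbf{B}$ and $\mathbf{L}$ is $\mathcal{K}_{\mathbf{B}}(\mathbf{L}):=\mathcal{K}(\mathbf{L}^B,\lambda)$ with $\lambda(x)(i)=x(\beta(i))$. For a B-cycle homomorphism $g\colon\mathbf{B}\to\mathbf{C}$, $\mathcal{K}_g(\mathbf{L})\colon\mathcal{K}_{\mathbf{C}}(\mathbf{L})\to\mathcal{K}_{\mathbf{B}}(\mathbf{L})$ is the homomorphism $x\mapsto x\circ g$. $[\mathbf{A},\mathbf{L}]=([A,L];\lambda)$ is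 the B-cycle where $[A,L]$ is the set of all residuated lattice homomorphisms $\alpha\colon\mathbf{F}_{\mathbf{A}}\to\mathbf{L}^-$ and $(\lambda(\alpha))(x):=\alpha(x^{\sim\sim})$. For a homomorphism $f\colon\mathbf{A}_1\to\mathbf{A}_2$ of perfect pseudo MV-algebras, $[f,\mathbf{L}]\colon[\mathbf{A}_2,\mathbf{L}]\to[\mathbf{A}_1,\mathbf{L}]$ is $\alpha\mapsto\alpha\circ f$ (restricted to $F_{\mathbf{A}_1}$). The homomorphism $\eta_{\mathbf{A}}\colon\mathbf{A}\to\mathcal{K}_{[\mathbf{A},\mathbf{L}]}(\mathbf{L})$ is given by $(\eta_{\mathbf{A}}(x))(\alpha)=\alpha(x)$ if $x\in F_{\mathbf{A}}$ and $(\eta_{\mathbf{A}}(x))(\alpha)=\alpha(x^{\sim})^{-1}$ if $x\in J_{\mathbf{A}}$. The B-cycle homomorphism $\varepsilon_{\mathbf{B}}\colon\mathbf{B}\to[\mathcal{K}_{\mathbf{B}}(\mathbf{L}),\mathbf{L}]$ sends $i\in B$ to the projection $\pi_i\colon(L^-)^B\to L^-$, $x\mapsto x(i)$ (recall $F_{\mathcal{K}_{\mathbf{B}}(\mathbf{L})}=(L^-)^B$). *)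

(* Defs.v *)
From HB Require Import structures.
From mathcomp Require Import all_boot all_order.
From mathcomp Require Import boolp.

Set Implicit Arguments.
Unset Strict Implicit.
Unset Printing Implicit Defensive.

Import Order.Theory.
Local Open Scope group_scope.
Local Open Scope order_scope.

Reserved Notation "x '\ldiv' y" (at level 40, left associativity).
Reserved Notation "x '\rdiv' y" (at level 40, left associativity).
Reserved Notation "x ^l-" (at level 1, format "x ^l-").
Reserved Notation "x ^r~" (at level 1, format "x ^r~").

(* Common part of the signatures of residuated lattices and l-groups; no
   compatibility between order and product is assumed here. *)
HB.structure Definition LatticeMonoid d :=
  { T of Order.Lattice d T & Monoid T }.

(* [x \ldiv z] is the residual written x\z on paper, [z \rdiv y] is z/y; the
   notation [/] is kept for division in a group. *)
HB.mixin Record isResiduated d T of Order.Lattice d T & Monoid T := {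
  ldiv : T -> T -> T;
  rdiv : T -> T -> T;
  le_ldiv : forall x y z : T, (y <= ldiv x z)%O = (mul x y <= z)%O;
  le_rdiv : forall x y z : T, (x <= rdiv z y)%O = (mul x y <= z)%O
}.

#[short(type="resLatticeType")]
HB.structure Definition ResLattice d :=
  { T of isResiduated d T & Order.Lattice d T & Monoid T }.

Notation "x '\ldiv' y" := (ldiv x y) : group_scope.
Notation "x '\rdiv' y" := (rdiv x y) : group_scope.

(* The additional constant 0 is [\bot]; x^- is [x ^l-] and x^~ is [x ^r~]. *)
HB.mixin Record isFLw d T of ResLattice d T & Order.TBLattice d T := {
  top_eq1 : \top%O = one :> T
}.

#[short(type="flwType")]
HB.structure Definition FLw d :=
  { T of isFLw d T & ResLattice d T & Order.TBLattice d T }.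

Definition lneg d (A : flwType d) (x : A) : A := \bot \rdiv x.
Definition rneg d (A : flwType d) (x : A) : A := x \ldiv \bot.
Notation "x ^l-" := (lneg x) : group_scope.
Notation "x ^r~" := (rneg x) : group_scope.

HB.mixin Record isPseudoMV d T of FLw d T := {
  rdiv_ldiv : forall x y : T, rdiv x (ldiv y x) = (x `|` y)%O;
  ldiv_rdiv : forall x y : T, ldiv (rdiv x y) x = (x `|` y)%O
}.

#[short(type="pseudoMVType")]
HB.structure Definition PseudoMV d := { T of isPseudoMV d T & FLw d T }.

Record reslat_hom d d' (A : resLatticeType d) (B : resLatticeType d') :=
  ResLatHom {
  reslat_fun :> A -> B;
  reslat_homI : {morph reslat_fun : x y / x `&` y};
  reslat_homU : {morph reslat_fun : x y / x `|` y};
  reslat_homM : {morph reslat_fun : x y / x * y};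
  reslat_homL : {morph reslat_fun : x y / x \ldiv y};
  reslat_homR : {morph reslat_fun : x y / x \rdiv y};
  reslat_hom1 : reslat_fun 1 = 1
}.

Record flw_hom d d' (A : flwType d) (B : flwType d') := FLwHom {
  flw_reslat :> reslat_hom A B;
  flw_hom0 : flw_reslat \bot = \bot
}.

(* The two-element Boolean algebra as an FL_w-algebra: product is conjunction
   and both residuals are implication. *)
Lemma bool_le_ldiv (x y z : bool) : (y <= (x ==> z)) = (x && y <= z).
Proof. by case: x y z => [] [] []. Qed.

Lemma bool_le_rdiv (x y z : bool) : (x <= (y ==> z)) = (x && y <= z).
Proof. by case: x y z => [] [] []. Qed.

HB.instance Definition _ := isMonoid.Build bool andbA andTb andbT.
HB.instance Definition _ :=
  isResiduated.Build _ bool bool_le_ldiv bool_le_rdiv.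
HB.instance Definition _ := isFLw.Build _ bool erefl.

(* The map h_A onto the two-element algebra is part of the structure; it is
   unique, see [perfh_unique]. *)
HB.mixin Record isPerfect d T of FLw d T := {
  perfh : flw_hom T bool;
  perfh_le : forall x y : T, perfh x = false -> perfh y = true -> (x <= y)%O
}.

#[short(type="perfectPMVType")]
HB.structure Definition PerfectPMV d := { T of isPerfect d T & PseudoMV d T }.

HB.mixin Record isLGroup d T of Order.Lattice d T & Group T := {
  lemul2l : forall z x y : T, (x <= y)%O -> (mul z x <= mul z y)%O;
  lemul2r : forall z x y : T, (x <= y)%O -> (mul x z <= mul y z)%O
}.

#[short(type="lgroupType")]
HB.structure Definition LGroup d :=
  { T of isLGroup d T & Order.Lattice d T & Group T }.

Section LGroupTheory.
Context d (L : lgroupType d).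
Implicit Types x y z : L.

Lemma lemulgE x y z : (x * y <= z) = (y <= x^-1 * z).
Proof.
apply/idP/idP => /(lemul2l _) h.
  by have := h x^-1; rewrite mulKg.
by have := h x; rewrite mulVKg.
Qed.

Lemma lemulgEr x y z : (x * y <= z) = (x <= z * y^-1).
Proof.
apply/idP/idP => /(lemul2r _) h.
  by have := h y^-1; rewrite mulgK.
by have := h y; rewrite mulgVK.
Qed.

Lemma eq_from_ge x y : (forall w, (x <= w) = (y <= w)) -> x = y.
Proof. by move=> h; apply/le_anti; rewrite h lexx -h lexx. Qed.

Lemma eq_from_le x y : (forall w, (w <= x) = (w <= y)) -> x = y.
Proof. by move=> h; apply/le_anti; rewrite -h lexx h lexx. Qed.

Lemma mulgUl x y z : (x `|` y) * z = x * z `|` y * z.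
Proof. by apply: eq_from_ge => w; rewrite lemulgEr !leUx !lemulgEr. Qed.

Lemma mulgUr x y z : z * (x `|` y) = z * x `|` z * y.
Proof. by apply: eq_from_ge => w; rewrite lemulgE !leUx !lemulgE. Qed.

Lemma le_gmulE x y z : (y <= x * z) = (x^-1 * y <= z).
Proof. by rewrite lemulgE invgK. Qed.

Lemma le_gmulEr x y z : (y <= z * x) = (y * x^-1 <= z).
Proof. by rewrite lemulgEr invgK. Qed.

Lemma mulgIl x y z : (x `&` y) * z = x * z `&` y * z.
Proof. by apply: eq_from_le => w; rewrite le_gmulEr !lexI !le_gmulEr. Qed.

Lemma mulgIr x y z : z * (x `&` y) = z * x `&` z * y.
Proof. by apply: eq_from_le => w; rewrite le_gmulE !lexI !le_gmulE. Qed.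

Lemma leinvE x y : (x^-1 <= y) = (y^-1 <= x).
Proof.
by rewrite -[x^-1]mulg1 lemulgE invgK -[y^-1]mul1g -le_gmulEr.
Qed.

Lemma le_invE x y : (y <= x^-1) = (x <= y^-1).
Proof.
by rewrite -[x^-1]mulg1 -lemulgE -[y^-1]mul1g -lemulgEr.
Qed.

Lemma invgU x y : (x `|` y)^-1 = x^-1 `&` y^-1.
Proof. by apply: eq_from_le => w; rewrite lexI !(le_invE _ w) leUx. Qed.

Lemma invgI x y : (x `&` y)^-1 = x^-1 `|` y^-1.
Proof. by apply: invg_inj; rewrite invgU !invgK. Qed.

End LGroupTheory.

Record negcone d (L : lgroupType d) := NegCone {
  negcone_val : L;
  _ : negcone_val <= 1
}.

Record poscone d (L : lgroupType d) := PosCone {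
  poscone_val : L;
  _ : 1 <= poscone_val
}.

Section Cones.
Context d (L : lgroupType d).

HB.instance Definition _ := [isSub for @negcone_val d L].
HB.instance Definition _ := [Choice of negcone L by <:].
HB.instance Definition _ := [isSub for @poscone_val d L].
HB.instance Definition _ := [Choice of poscone L by <:].

Lemma negcone_meet_closed : Order.ClosedPredicates.meet_closed (fun x : L => x <= 1).
Proof. by move=> x y x1 y1; apply: leIxl. Qed.

Lemma negcone_join_closed : Order.ClosedPredicates.join_closed (fun x : L => x <= 1).
Proof. by move=> x y x1 y1; rewrite -topredE /= leUx; apply/andP. Qed.

Lemma negcone_monoid_closed : monoid_closed (fun x : L => x <= 1).
Proof.
split=> [|x y x1 y1]; first by rewrite -topredE /= lexx.
rewrite -topredE /=; apply: le_trans (lemul2l x _ _ y1) _.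
by rewrite mulg1.
Qed.

Lemma poscone_meet_closed : Order.ClosedPredicates.meet_closed (fun x : L => 1 <= x).
Proof. by move=> x y x1 y1; rewrite -topredE /= lexI; apply/andP. Qed.

Lemma poscone_join_closed : Order.ClosedPredicates.join_closed (fun x : L => 1 <= x).
Proof. by move=> x y x1 y1; apply: lexUl. Qed.

HB.instance Definition _ :=
  Order.SubChoice_isSubLattice.Build d L (fun x => x <= 1) d (negcone L)
    negcone_meet_closed negcone_join_closed.
HB.instance Definition _ :=
  SubChoice_isSubMonoid.Build L (fun x => x <= 1) (negcone L)
    negcone_monoid_closed.
HB.instance Definition _ :=
  Order.SubChoice_isSubLattice.Build d L (fun x => 1 <= x) d (poscone L)
    poscone_meet_closed poscone_join_closed.

Definition negpart (x : L) : negcone L := NegCone (leIr 1 x).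
Definition pospart (x : L) : poscone L := PosCone (leUr 1 x).

Lemma negcone_le1 (x : negcone L) : val x <= 1. Proof. by case: x. Qed.
Lemma poscone_ge1 (x : poscone L) : 1 <= val x. Proof. by case: x. Qed.

Lemma le_negpart (x : negcone L) y : (x <= negpart y) = (val x <= y).
Proof. by rewrite -Order.le_val /= lexI negcone_le1 andbT. Qed.

Lemma pospart_le (x : poscone L) y : (pospart y <= x) = (y <= val x).
Proof. by rewrite -Order.le_val /= leUx poscone_ge1 andbT. Qed.

Lemma negcone_le_ldiv (x y z : negcone L) :
  (y <= negpart ((val x)^-1 * val z)) = (x * y <= z).
Proof. by rewrite le_negpart -lemulgE. Qed.

Lemma negcone_le_rdiv (x y z : negcone L) :
  (x <= negpart (val z * (val y)^-1)) = (x * y <= z).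
Proof. by rewrite le_negpart -lemulgEr. Qed.

HB.instance Definition _ :=
  isResiduated.Build d (negcone L) negcone_le_ldiv negcone_le_rdiv.

End Cones.

Lemma bijective_inverse T (f : T -> T) :
  bijective f -> {g | cancel f g /\ cancel g f}.
Proof. by move=> bf; apply: cid; case: bf => g fK gK; exists g. Qed.

Definition bij_inv T (f : T -> T) (bf : bijective f) : T -> T :=
  sval (bijective_inverse bf).

Lemma bij_invK T (f : T -> T) (bf : bijective f) : cancel f (bij_inv bf).
Proof. by rewrite /bij_inv; case: bijective_inverse => g []. Qed.

Lemma bij_invKV T (f : T -> T) (bf : bijective f) : cancel (bij_inv bf) f.
Proof. by rewrite /bij_inv; case: bijective_inverse => g []. Qed.

Record lgroup_aut d (L : lgroupType d) := LGroupAut {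
  aut_fun :> L -> L;
  aut_bij : bijective aut_fun;
  autM : {morph aut_fun : x y / x * y};
  autI : {morph aut_fun : x y / x `&` y};
  autU : {morph aut_fun : x y / x `|` y}
}.

Section Automorphism.
Context d (L : lgroupType d) (lam : lgroup_aut L).
Implicit Types x y : L.

Definition aut_inv : L -> L := bij_inv (aut_bij lam).

Lemma autK : cancel lam aut_inv. Proof. exact: bij_invK. Qed.
Lemma autVK : cancel aut_inv lam. Proof. exact: bij_invKV. Qed.

Lemma aut1 : lam 1 = 1.
Proof. by apply: (@mulgI _ (lam 1)); rewrite -autM !mulg1. Qed.

Lemma autV x : lam x^-1 = (lam x)^-1.
Proof. by apply: (@mulgI _ (lam x)); rewrite -autM !mulgV aut1. Qed.

Lemma aut_le x y : (lam x <= lam y) = (x <= y).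
Proof. by rewrite !leEmeet -autI (inj_eq (can_inj autK)). Qed.

Lemma aut_le1 x : (lam x <= 1) = (x <= 1).
Proof. by rewrite -{1}aut1 aut_le. Qed.

Lemma le_aut x y : (lam x <= y) = (x <= aut_inv y).
Proof. by rewrite -{1}(autVK y) aut_le. Qed.

End Automorphism.

(* [inl] embeds L^- and [inr] embeds L^+. *)
Definition kite d (L : lgroupType d) (lam : lgroup_aut L) : Type :=
  (negcone L + poscone L)%type.

Section Kite.
Context d (L : lgroupType d) (lam : lgroup_aut L).
Local Notation K := (kite lam).

HB.instance Definition _ := Choice.copy K (negcone L + poscone L)%type.

Definition kite_le (x y : K) : bool :=
  match x, y with
  | inl a, inl b => a <= b
  | inl _, inr _ => false
  | inr _, inl _ => true
  | inr a, inr b => a <= b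
  end.

Definition kite_meet (x y : K) : K :=
  match x, y with
  | inl a, inl b => inl (a `&` b)
  | inl _, inr b => inr b
  | inr a, inl _ => inr a
  | inr a, inr b => inr (a `&` b)
  end.

Definition kite_join (x y : K) : K :=
  match x, y with
  | inl a, inl b => inl (a `|` b)
  | inl a, inr _ => inl a
  | inr _, inl b => inl b
  | inr a, inr b => inr (a `|` b)
  end.

Definition kite_one : K := inl 1.
Definition kite_zero : K := inr (PosCone (lexx 1)).

Definition kite_mul (x y : K) : K :=
  match x, y with
  | inl a, inl b => inl (a * b)
  | inl a, inr b => inr (pospart (lam (val a) * val b))
  | inr a, inl b => inr (pospart (val a * val b))
  | inr _, inr _ => kite_zero
  end.

Definition kite_ldiv (x z : K) : K :=
  match x, z with
  | inl a, inl c => inl (negpart ((val a)^-1 * val c))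
  | inl a, inr c => inr (pospart ((lam (val a))^-1 * val c))
  | inr _, inl _ => kite_one
  | inr a, inr c => inl (negpart ((val a)^-1 * val c))
  end.

Definition kite_rdiv (z y : K) : K :=
  match z, y with
  | inl c, inl b => inl (negpart (val c * (val b)^-1))
  | inl _, inr _ => kite_one
  | inr c, inl b => inr (pospart (val c * (val b)^-1))
  | inr c, inr b => inl (negpart (aut_inv lam (val c * (val b)^-1)))
  end.

Lemma kite_le_refl : reflexive kite_le.
Proof. by case=> a /=. Qed.

Lemma kite_le_anti : antisymmetric kite_le.
Proof. by case=> a [b|b] //= /le_anti ->. Qed.

Lemma kite_le_trans : transitive kite_le.
Proof. by case=> b [a|a] [c|c] //=; apply: le_trans. Qed.

HB.instance Definition _ :=
  Order.Le_isPOrder.Build d K kite_le_refl kite_le_anti kite_le_trans.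

Lemma kite_lexI (x y z : K) :
  (x <= kite_meet y z) = (x <= y) && (x <= z).
Proof.
rewrite /Order.le /=.
by case: x y z => [a|a] [b|b] [c|c] //=; rewrite ?lexI ?andbT ?andbF.
Qed.

Lemma kite_leUx (x y z : K) :
  (kite_join x y <= z) = (x <= z) && (y <= z).
Proof.
rewrite /Order.le /=.
by case: x y z => [a|a] [b|b] [c|c] //=; rewrite ?leUx ?andbT ?andbF.
Qed.

HB.instance Definition _ :=
  Order.POrder_MeetJoin_isLattice.Build d K kite_lexI kite_leUx.

Lemma kite_leE (x y : K) : (x <= y) = kite_le x y. Proof. by []. Qed.

Lemma kite_le0x (x : K) : kite_zero <= x.
Proof. by case: x => a; rewrite kite_leE //= -Order.le_val /= poscone_ge1. Qed.

Lemma kite_lex1 (x : K) : x <= kite_one.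
Proof.
by case: x => a; rewrite kite_leE //= -Order.le_val /= negcone_le1.
Qed.

HB.instance Definition _ := Order.hasBottom.Build d K kite_le0x.
HB.instance Definition _ := Order.hasTop.Build d K kite_lex1.

Lemma pospart_mulr (x y : L) : x <= 1 -> (y * x `|` 1) = (y `|` 1) * x `|` 1.
Proof. by move=> x1; rewrite mulgUl mul1g -joinA (join_r x1). Qed.

Lemma pospart_mull (x y : L) : x <= 1 -> (x * y `|` 1) = x * (y `|` 1) `|` 1.
Proof. by move=> x1; rewrite mulgUr mulg1 -joinA (join_r x1). Qed.

Lemma kite_mulA : associative kite_mul.
Proof.
case=> a [b|b] [c|c] //=; try (congr inr; apply: val_inj => /=).
- by rewrite mulgA.
- by rewrite autM -pospart_mull ?aut_le1 ?negcone_le1 // mulgA.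
- rewrite -pospart_mull ?aut_le1 ?negcone_le1 //.
  by rewrite -pospart_mulr ?negcone_le1 // mulgA.
- by rewrite mulg1 join_r // aut_le1 negcone_le1.
- by rewrite -pospart_mulr ?negcone_le1 // mulgA.
- by rewrite mul1g join_r // negcone_le1.
Qed.

Lemma kite_mul1 : left_id kite_one kite_mul.
Proof.
case=> a /=; first by rewrite mul1g.
by congr inr; apply: val_inj => /=; rewrite aut1 mul1g join_l ?poscone_ge1.
Qed.

Lemma kite_mulr1 : right_id kite_one kite_mul.
Proof.
case=> a /=; first by rewrite mulg1.
by congr inr; apply: val_inj => /=; rewrite mulg1 join_l ?poscone_ge1.
Qed.

HB.instance Definition _ :=
  isMonoid.Build K kite_mulA kite_mul1 kite_mulr1.

Lemma divl_ge1 (a : negcone L) (c : poscone L) : 1 <= (val a)^-1 * val c.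
Proof.
rewrite le_gmulE invgK mulg1.
exact: le_trans (negcone_le1 a) (poscone_ge1 c).
Qed.

Lemma divr_ge1 (a : negcone L) (c : poscone L) : 1 <= val c * (val a)^-1.
Proof.
rewrite le_gmulEr invgK mul1g.
exact: le_trans (negcone_le1 a) (poscone_ge1 c).
Qed.

Lemma aut_divl_ge1 (a : negcone L) (c : poscone L) :
  1 <= (lam (val a))^-1 * val c.
Proof.
rewrite le_gmulE invgK mulg1; apply: le_trans _ (poscone_ge1 c).
by rewrite aut_le1 negcone_le1.
Qed.

Lemma kite_le_ldiv (x y z : K) : (y <= kite_ldiv x z) = (x * y <= z).
Proof.
rewrite !kite_leE; case: x y z => [a|a] [b|b] [c|c] //=.
- by rewrite le_negpart -lemulgE.
- by rewrite pospart_le lemulgE -Order.le_val /= join_l ?aut_divl_ge1.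
- by rewrite -Order.le_val /= negcone_le1.
- by rewrite le_negpart pospart_le lemulgE.
- by rewrite -Order.le_val /= poscone_ge1.
Qed.

Lemma kite_le_rdiv (x y z : K) : (x <= kite_rdiv z y) = (x * y <= z).
Proof.
rewrite !kite_leE; case: x y z => [a|a] [b|b] [c|c] //=.
- by rewrite le_negpart -lemulgEr.
- by rewrite -Order.le_val /= negcone_le1.
- by rewrite le_negpart pospart_le -le_aut lemulgEr.
- by rewrite pospart_le lemulgEr -Order.le_val /= join_l ?divr_ge1.
- by rewrite -Order.le_val /= poscone_ge1.
Qed.

HB.instance Definition _ := isResiduated.Build d K kite_le_ldiv kite_le_rdiv.
HB.instance Definition _ := isFLw.Build d K erefl.

Lemma mul_divI (u v : L) : u * (v^-1 * u `&` 1)^-1 = u `|` v.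
Proof. by rewrite invgI invgM invgK invg1 mulgUr mulVKg mulg1 joinC. Qed.

Lemma divI_mul (u v : L) : (u * v^-1 `&` 1)^-1 * u = u `|` v.
Proof. by rewrite invgI invgF invg1 mulgUl mulgVK mul1g joinC. Qed.

Lemma kite_rdiv_ldiv (x y : K) : rdiv x (ldiv y x) = x `|` y.
Proof.
case: x y => [a|a] [b|b]; [congr inl|congr inl|congr inl|congr inr];
  apply: val_inj; rewrite /=.
- by rewrite mul_divI meet_l // leUx !negcone_le1.
- by rewrite invg1 mulg1 meet_l ?negcone_le1.
- rewrite [_ `|` 1]join_l ?aut_divl_ge1 // invgM invgK mulVKg autK.
  by rewrite meet_l ?negcone_le1.
- by rewrite mul_divI join_l // lexUl ?poscone_ge1.
Qed.

Lemma kite_ldiv_rdiv (x y : K) : ldiv (rdiv x y) x = x `|` y.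
Proof.
case: x y => [a|a] [b|b]; [congr inl|congr inl|congr inl|congr inr];
  apply: val_inj; rewrite /=.
- by rewrite divI_mul meet_l // leUx !negcone_le1.
- by rewrite invg1 mul1g meet_l ?negcone_le1.
- rewrite [_ `|` 1]join_l ?divr_ge1 // invgF mulgVK.
  by rewrite meet_l ?negcone_le1.
- by rewrite autI autVK aut1 divI_mul join_l // lexUl ?poscone_ge1.
Qed.

HB.instance Definition _ := isPseudoMV.Build d K kite_rdiv_ldiv kite_ldiv_rdiv.

Definition kite_h (x : K) : bool := if x is inl _ then true else false.

Definition kite_reslat_h : reslat_hom K bool.
Proof. by exists kite_h => // -[a|a] [b|b]. Defined.

Definition kite_flw_h : flw_hom K bool :=
  @FLwHom _ _ K bool kite_reslat_h erefl.

Lemma kite_h_le (x y : K) :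
  kite_flw_h x = false -> kite_flw_h y = true -> x <= y.
Proof. by case: x y => a [b|b]. Qed.

HB.instance Definition _ := isPerfect.Build d K kite_h_le.

End Kite.

Section Perfect.
Context d (A : perfectPMVType d).
Implicit Types x y z : A.

Lemma perfh_unique (h : flw_hom A bool) x : h x = perfh x.
Proof.
have hM := reslat_homM h; have hL := reslat_homL h; have h0 := flw_hom0 h.
case px: (perfh x); last first.
  have xx0 : x * x = \bot.
    apply/le_anti; rewrite le0x andbT -le_ldiv; apply: perfh_le => //.
    by rewrite (reslat_homL perfh) px.
  by have := hM x x; rewrite xx0 h0; case: (h x).
have xl : x^r~ * x^r~ = \bot.
  apply/le_anti; rewrite le0x andbT -le_ldiv; apply: perfh_le.
    by rewrite (reslat_homL perfh) px (flw_hom0 perfh).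
  by rewrite !(reslat_homL perfh) px (flw_hom0 perfh).
by have := hM x^r~ x^r~; rewrite xl h0 hL h0; case: (h x).
Qed.

End Perfect.


Lemma reslat_hom_ext d d' (A : resLatticeType d) (B : resLatticeType d')
  (f g : reslat_hom A B) : f =1 g -> f = g.
Proof.
case: f g => [f fI fU fM fL fR f1] [g gI gU gM gL gR g1] /= /funext fg.
by subst g; congr ResLatHom; apply: Prop_irrelevance.
Qed.

Lemma flw_hom_ext d d' (A : flwType d) (B : flwType d') (f g : flw_hom A B) :
  f =1 g -> f = g.
Proof.
case: f g => [f f0] [g g0] /= /reslat_hom_ext fg.
by subst g; congr FLwHom; apply: Prop_irrelevance.
Qed.

Section Composition.
Context (d1 d2 d3 : Order.disp_t).

Definition reslat_comp (A : resLatticeType d1) (B : resLatticeType d2)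
  (C : resLatticeType d3) (g : reslat_hom B C) (f : reslat_hom A B) :
  reslat_hom A C.
Proof.
exists (g \o f).
- by move=> x y /=; rewrite !reslat_homI.
- by move=> x y /=; rewrite !reslat_homU.
- by move=> x y /=; rewrite !reslat_homM.
- by move=> x y /=; rewrite !reslat_homL.
- by move=> x y /=; rewrite !reslat_homR.
- by rewrite /= !reslat_hom1.
Defined.

Definition flw_comp (A : flwType d1) (B : flwType d2) (C : flwType d3)
  (g : flw_hom B C) (f : flw_hom A B) : flw_hom A C.
Proof. by exists (reslat_comp g f); rewrite /= !flw_hom0. Defined.

End Composition.

Section PseudoMVTheory.
Context d (A : pseudoMVType d).
Implicit Types x y z : A.

Lemma rnegK x : x^r~^l- = x.
Proof. by rewrite /lneg /rneg rdiv_ldiv join0x. Qed.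

Lemma lnegK x : x^l-^r~ = x.
Proof. by rewrite /lneg /rneg ldiv_rdiv join0x. Qed.

Lemma le_rneg x y : (y <= x^r~) = (x <= y^l-).
Proof. by rewrite /rneg /lneg le_ldiv le_rdiv. Qed.

Lemma le_rneg2 x y : (x^r~ <= y^r~) = (y <= x).
Proof. by rewrite le_rneg rnegK. Qed.

Lemma le_lneg2 x y : (x^l- <= y^l-) = (y <= x).
Proof. by rewrite -le_rneg lnegK. Qed.

Lemma pmv_eq_le x y : (forall w, (w <= x) = (w <= y)) -> x = y.
Proof. by move=> h; apply/le_anti; rewrite -h lexx h lexx. Qed.

Lemma lnegU x y : (x `|` y)^l- = x^l- `&` y^l-.
Proof. by apply: pmv_eq_le => w; rewrite lexI -!le_rneg leUx. Qed.

Lemma rnegU x y : (x `|` y)^r~ = x^r~ `&` y^r~.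
Proof. by apply: pmv_eq_le => w; rewrite lexI !le_rneg leUx. Qed.

Lemma rnegI x y : (x `&` y)^r~ = x^r~ `|` y^r~.
Proof. by rewrite -[RHS]lnegK lnegU !rnegK. Qed.

Lemma lnegI x y : (x `&` y)^l- = x^l- `|` y^l-.
Proof. by rewrite -[RHS]rnegK rnegU !lnegK. Qed.

Lemma rnegM x y : (x * y)^r~ = y \ldiv x^r~.
Proof. by apply: pmv_eq_le => w; rewrite !le_ldiv mulgA. Qed.

Lemma lnegM x y : (x * y)^l- = y^l- \rdiv x.
Proof. by apply: pmv_eq_le => w; rewrite !le_rdiv mulgA. Qed.

Lemma ldivE x z : x \ldiv z = (z^l- * x)^r~.
Proof. by rewrite rnegM lnegK. Qed.

Lemma rdivE z y : z \rdiv y = (y * z^r~)^l-.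
Proof. by rewrite lnegM rnegK. Qed.

Lemma ldiv_rneg x z : x \ldiv z = x^r~ \rdiv z^r~.
Proof.
apply: pmv_eq_le => w; rewrite le_rdiv [RHS]le_ldiv le_ldiv mulgA.
by rewrite -[z in LHS]rnegK le_rdiv.
Qed.

Lemma rneg2M x y : (x * y)^r~^r~ = x^r~^r~ * y^r~^r~.
Proof.
have: y \ldiv x^r~ = y^r~ \rdiv x^r~^r~ by exact: ldiv_rneg.
by rewrite -rnegM rdivE => ->; rewrite lnegK.
Qed.

Lemma rneg2I x y : (x `&` y)^r~^r~ = x^r~^r~ `&` y^r~^r~.
Proof. by rewrite rnegI rnegU. Qed.

Lemma rneg2U x y : (x `|` y)^r~^r~ = x^r~^r~ `|` y^r~^r~.
Proof. by rewrite rnegU rnegI. Qed.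

Lemma rneg2L x y : (x \ldiv y)^r~^r~ = x^r~^r~ \ldiv y^r~^r~.
Proof. by rewrite !ldivE rneg2M lnegK !rnegK. Qed.

Lemma rneg2R x y : (x \rdiv y)^r~^r~ = x^r~^r~ \rdiv y^r~^r~.
Proof. by rewrite !rdivE -rneg2M !(rnegK, lnegK). Qed.

Lemma rneg1 : (1 : A)^r~ = \bot.
Proof. by apply: pmv_eq_le => w; rewrite le_ldiv mul1g. Qed.

Lemma lneg1 : (1 : A)^l- = \bot.
Proof. by apply: pmv_eq_le => w; rewrite le_rdiv mulg1. Qed.

Lemma rneg0 : (\bot : A)^r~ = 1.
Proof. by rewrite -lneg1 lnegK. Qed.

Lemma rneg21 : (1 : A)^r~^r~ = 1.
Proof. by rewrite rneg1 rneg0. Qed.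

End PseudoMVTheory.

Section PseudoMVHom.
Context d d' (A : pseudoMVType d) (B : pseudoMVType d') (f : A -> B).
Hypotheses (fI : {morph f : x y / x `&` y}) (fU : {morph f : x y / x `|` y})
  (fM : {morph f : x y / x * y}) (f1 : f 1 = 1)
  (frneg : {morph f : x / x^r~}) (flneg : {morph f : x / x^l-}).

Lemma pseudoMV_homL : {morph f : x y / x \ldiv y}.
Proof. by move=> x y; rewrite !ldivE frneg fM flneg. Qed.

Lemma pseudoMV_homR : {morph f : x y / x \rdiv y}.
Proof. by move=> x y; rewrite !rdivE flneg fM frneg. Qed.

Lemma pseudoMV_hom0 : f \bot = \bot.
Proof. by rewrite -rneg1 frneg f1 rneg1. Qed.

Definition pseudoMV_hom : flw_hom A B :=
  @FLwHom _ _ A B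
    (@ResLatHom _ _ A B f fI fU fM pseudoMV_homL pseudoMV_homR f1)
    pseudoMV_hom0.

End PseudoMVHom.

Record filtpart d (A : perfectPMVType d) := FiltPart {
  filt_val : A;
  _ : perfh filt_val
}.

Section FiltPart.
Context d (A : perfectPMVType d).
Implicit Types x y z : A.

HB.instance Definition _ := [isSub for @filt_val d A].
HB.instance Definition _ := [Choice of filtpart A by <:].

Let S := (fun x : A => perfh x : bool).

Lemma filt_meet_closed : Order.ClosedPredicates.meet_closed S.
Proof.
move=> x y xS yS; rewrite -topredE /= /S (reslat_homI perfh).
by rewrite [perfh x]xS [perfh y]yS.
Qed.

Lemma filt_join_closed : Order.ClosedPredicates.join_closed S.
Proof.
move=> x y xS yS; rewrite -topredE /= /S (reslat_homU perfh).
by rewrite [perfh x]xS [perfh y]yS.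
Qed.

Lemma filt_monoid_closed : monoid_closed S.
Proof.
split=> [|x y xS yS]; rewrite -topredE /= /S.
  by rewrite (reslat_hom1 perfh).
by rewrite (reslat_homM perfh) [perfh x]xS [perfh y]yS.
Qed.

HB.instance Definition _ :=
  Order.SubChoice_isSubLattice.Build d A S d (filtpart A)
    filt_meet_closed filt_join_closed.
HB.instance Definition _ :=
  SubChoice_isSubMonoid.Build A S (filtpart A) filt_monoid_closed.

Lemma filtP (a : filtpart A) : perfh (val a). Proof. by case: a. Qed.

Lemma filt_ldiv_subproof (a b : filtpart A) : perfh (val a \ldiv val b).
Proof. by rewrite (reslat_homL perfh) !filtP. Qed.

Lemma filt_rdiv_subproof (a b : filtpart A) : perfh (val a \rdiv val b).
Proof. by rewrite (reslat_homR perfh) !filtP. Qed.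

Definition filt_ldiv (a b : filtpart A) := FiltPart (filt_ldiv_subproof a b).
Definition filt_rdiv (a b : filtpart A) := FiltPart (filt_rdiv_subproof a b).

Lemma filt_le_ldiv a b c : (b <= filt_ldiv a c) = (a * b <= c).
Proof. by rewrite -!Order.le_val /= le_ldiv. Qed.

Lemma filt_le_rdiv a b c : (a <= filt_rdiv c b) = (a * b <= c).
Proof. by rewrite -!Order.le_val /= le_rdiv. Qed.

HB.instance Definition _ :=
  isResiduated.Build d (filtpart A) filt_le_ldiv filt_le_rdiv.

Lemma perfh_rneg x : perfh x^r~ = ~~ perfh x.
Proof. by rewrite (reslat_homL perfh) (flw_hom0 perfh); case: (perfh x). Qed.

Lemma perfh_lneg x : perfh x^l- = ~~ perfh x.
Proof. by rewrite (reslat_homR perfh) (flw_hom0 perfh); case: (perfh x). Qed.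

Lemma filt_rneg2_subproof (a : filtpart A) : perfh (val a)^r~^r~.
Proof. by rewrite !perfh_rneg negbK filtP. Qed.

Lemma filt_lneg2_subproof (a : filtpart A) : perfh (val a)^l-^l-.
Proof. by rewrite !perfh_lneg negbK filtP. Qed.

Definition filt_rneg2 (a : filtpart A) := FiltPart (filt_rneg2_subproof a).
Definition filt_lneg2 (a : filtpart A) := FiltPart (filt_lneg2_subproof a).

Lemma filt_rneg2K : cancel filt_rneg2 filt_lneg2.
Proof. by move=> a; apply: val_inj; rewrite /= !rnegK. Qed.

Lemma filt_lneg2K : cancel filt_lneg2 filt_rneg2.
Proof. by move=> a; apply: val_inj; rewrite /= !lnegK. Qed.

Definition filt_rneg2_hom : reslat_hom (filtpart A) (filtpart A).
Proof.
exists filt_rneg2 => [a b|a b|a b|a b|a b|]; apply: val_inj.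
- exact: rneg2I.
- exact: rneg2U.
- exact: rneg2M.
- exact: rneg2L.
- exact: rneg2R.
- exact: rneg21.
Defined.

Lemma filt_lneg2_morph (op : filtpart A -> filtpart A -> filtpart A) :
  {morph filt_rneg2 : a b / op a b} -> {morph filt_lneg2 : a b / op a b}.
Proof.
move=> fop a b; apply: (can_inj filt_rneg2K).
by rewrite fop !filt_lneg2K.
Qed.

Definition filt_lneg2_hom : reslat_hom (filtpart A) (filtpart A).
Proof.
exists filt_lneg2; try apply: filt_lneg2_morph.
- exact: (reslat_homI filt_rneg2_hom).
- exact: (reslat_homU filt_rneg2_hom).
- exact: (reslat_homM filt_rneg2_hom).
- exact: (reslat_homL filt_rneg2_hom).
- exact: (reslat_homR filt_rneg2_hom).
- apply: (can_inj filt_rneg2K); rewrite filt_lneg2K.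
  exact/esym/(reslat_hom1 filt_rneg2_hom).
Defined.

End FiltPart.

Section FiltMap.
Context d1 d2 (A1 : perfectPMVType d1) (A2 : perfectPMVType d2).
Variable f : flw_hom A1 A2.

Lemma perfh_hom (x : A1) : perfh (f x) = perfh x.
Proof. exact: (perfh_unique (flw_comp perfh f)). Qed.

Lemma filt_map_subproof (a : filtpart A1) : perfh (f (val a)).
Proof. by rewrite perfh_hom filtP. Qed.

Definition filt_map_fun (a : filtpart A1) : filtpart A2 :=
  FiltPart (filt_map_subproof a).

Definition filt_map : reslat_hom (filtpart A1) (filtpart A2).
Proof.
exists filt_map_fun => [a b|a b|a b|a b|a b|]; apply: val_inj.
- exact: (reslat_homI f).
- exact: (reslat_homU f).
- exact: (reslat_homM f).
- exact: (reslat_homL f).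
- exact: (reslat_homR f).
- exact: (reslat_hom1 f).
Defined.

Lemma hom_rneg x : f x^r~ = (f x)^r~.
Proof. by rewrite /rneg (reslat_homL f) (flw_hom0 f). Qed.

End FiltMap.

Record bcycle := BCycle {
  bcycle_sort :> Type;
  bcycle_fun : bcycle_sort -> bcycle_sort;
  bcycle_bij : bijective bcycle_fun
}.

Record bcycle_hom (B C : bcycle) := BCycleHom {
  bcycle_hom_fun :> B -> C;
  bcycle_homE : {morph bcycle_hom_fun : i / bcycle_fun i}
}.

Definition bcycle_comp (B C D : bcycle) (h : bcycle_hom C D)
  (g : bcycle_hom B C) : bcycle_hom B D.
Proof. by exists (h \o g) => i /=; rewrite !bcycle_homE. Defined.

(* L^B is the function type [B -> L]; its pointwise lattice structure is
   provided by boolp. *)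
Section Power.
Context (B : Type) d (L : lgroupType d).
Implicit Types x y z : B -> L.

Definition pow_one : B -> L := fun=> 1.
Definition pow_mul x y : B -> L := fun i => x i * y i.
Definition pow_inv x : B -> L := fun i => (x i)^-1.

Lemma pow_mulA : associative pow_mul.
Proof. by move=> x y z; apply: funext => i; apply: mulgA. Qed.
Lemma pow_mul1 : left_id pow_one pow_mul.
Proof. by move=> x; apply: funext => i; apply: mul1g. Qed.
Lemma pow_mulr1 : right_id pow_one pow_mul.
Proof. by move=> x; apply: funext => i; apply: mulg1. Qed.
Lemma pow_mulV : left_inverse pow_one pow_inv pow_mul.
Proof. by move=> x; apply: funext => i; apply: mulVg. Qed.
Lemma pow_mulrV : right_inverse pow_one pow_inv pow_mul.
Proof. by move=> x; apply: funext => i; apply: mulgV. Qed.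

HB.instance Definition _ :=
  isGroup.Build (B -> L) pow_mulA pow_mul1 pow_mulr1 pow_mulV pow_mulrV.

Lemma pow_lemul2l z x y : x <= y -> z * x <= z * y.
Proof. by move=> /lefP xy; apply/lefP => i; apply/lemul2l/xy. Qed.
Lemma pow_lemul2r z x y : x <= y -> x * z <= y * z.
Proof. by move=> /lefP xy; apply/lefP => i; apply/lemul2r/xy. Qed.

HB.instance Definition _ := isLGroup.Build _ (B -> L) pow_lemul2l pow_lemul2r.

End Power.

Section KiteOver.
Context (B : bcycle) d (L : lgroupType d).

Definition shift (x : B -> L) : B -> L := fun i => x (bcycle_fun i).

Lemma shift_bij : bijective shift.
Proof.
have [b bK Kb] := bcycle_bij B.
by exists (fun x i => x (b i)) => x; apply: funext => i; rewrite /shift ?bK ?Kb.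
Qed.

Definition shift_aut : lgroup_aut (B -> L).
Proof. by exists shift => //; exact: shift_bij. Defined.

Definition kite_over := kite shift_aut.

End KiteOver.

HB.instance Definition _ B d (L : lgroupType d) :=
  PerfectPMV.copy (kite_over B L) (kite (shift_aut B L)).

Section KiteMap.
Context (B C : bcycle) d (L : lgroupType d) (g : bcycle_hom B C).

Lemma comp_le1 (x : negcone (C -> L)) : (val x \o g : B -> L) <= 1.
Proof. by apply/lefP => i; have /lefP/(_ (g i)) := negcone_le1 x. Qed.

Lemma comp_ge1 (x : poscone (C -> L)) : 1 <= (val x \o g : B -> L).
Proof. by apply/lefP => i; have /lefP/(_ (g i)) := poscone_ge1 x. Qed.

Definition kite_map_fun (x : kite_over C L) : kite_over B L :=
  match x with
  | inl a => inl (NegCone (comp_le1 a))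
  | inr a => inr (PosCone (comp_ge1 a))
  end.

Lemma shift_comp (x : C -> L) : shift (x \o g) = shift x \o g.
Proof. by apply: funext => i; rewrite /shift /= bcycle_homE. Qed.

Lemma aut_inv_comp (x : C -> L) :
  aut_inv (shift_aut B L) (x \o g) = aut_inv (shift_aut C L) x \o g.
Proof.
apply: (can_inj (autK (shift_aut B L))); rewrite autVK /= shift_comp.
by rewrite -[in LHS](autVK (shift_aut C L) x).
Qed.

Lemma kite_mapI : {morph kite_map_fun : x y / x `&` y}.
Proof. by case=> a [b|b] //; [congr inl|congr inr]; apply: val_inj. Qed.

Lemma kite_mapU : {morph kite_map_fun : x y / x `|` y}.
Proof. by case=> a [b|b] //; [congr inl|congr inr]; apply: val_inj. Qed.

Lemma kite_mapM : {morph kite_map_fun : x y / x * y}.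
Proof.
case=> a [b|b]; [congr inl|congr inr|congr inr|congr inr];
  apply: val_inj => //=.
by rewrite shift_comp.
Qed.

Lemma kite_map1 : kite_map_fun 1 = 1.
Proof. by congr inl; apply: val_inj. Qed.

Lemma kite_map_rneg : {morph kite_map_fun : x / x^r~}.
Proof.
case=> a; [congr inr|congr inl]; apply: val_inj => //=.
by rewrite shift_comp.
Qed.

Lemma kite_map_lneg : {morph kite_map_fun : x / x^l-}.
Proof.
case=> a; [congr inr|congr inl]; apply: val_inj => //=.
by rewrite [aut_inv _ (1 * (val a \o g)^-1)](aut_inv_comp (1 * (val a)^-1)).
Qed.

Definition kite_map : flw_hom (kite_over C L) (kite_over B L) :=
  pseudoMV_hom kite_mapI kite_mapU kite_mapM kite_map1
    kite_map_rneg kite_map_lneg.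

End KiteMap.

(* [hom_cycle A L] is the B-cycle [A,L], with bijection
   lambda(alpha)(x) = alpha(x^~~), and [hom_cycle_map L f] is [f,L]. *)
Section HomCycle.
Context d d' (A : perfectPMVType d) (L : lgroupType d').

Definition hom_twist (alpha : reslat_hom (filtpart A) (negcone L)) :
    reslat_hom (filtpart A) (negcone L) :=
  reslat_comp alpha (filt_rneg2_hom A).

Lemma hom_twist_bij : bijective hom_twist.
Proof.
exists (fun alpha => reslat_comp alpha (filt_lneg2_hom A)) => alpha;
  apply: reslat_hom_ext => a /=.
- by rewrite filt_lneg2K.
- by rewrite filt_rneg2K.
Qed.

Definition hom_cycle : bcycle := BCycle hom_twist_bij.

End HomCycle.

Definition hom_cycle_map d1 d2 d (A1 : perfectPMVType d1)
  (A2 : perfectPMVType d2) (L : lgroupType d) (f : flw_hom A1 A2) :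
  bcycle_hom (hom_cycle A2 L) (hom_cycle A1 L).
Proof.
exists (fun alpha => reslat_comp alpha (filt_map f)) => alpha.
apply: reslat_hom_ext => a /=; congr (alpha _); apply: val_inj => /=.
by rewrite !hom_rneg.
Defined.

Section Eta.
Context d d' (A : perfectPMVType d) (L : lgroupType d').
Local Notation AL := (hom_cycle A L).
Implicit Types (x y : A) (a b : filtpart A).

Definition eval_filt a : AL -> L := fun alpha => val (alpha a).

Lemma eval_filt_le1 a : eval_filt a <= 1.
Proof. by apply/lefP => alpha; apply: negcone_le1. Qed.

Lemma eval_filt_inv_ge1 a : 1 <= (eval_filt a)^-1.
Proof. by rewrite le_invE invg1 eval_filt_le1. Qed.

Lemma radical_rneg x : ~~ perfh x -> perfh x^r~.
Proof. by rewrite perfh_rneg. Qed.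

(* The first case is x in F_A, the second x in J_A, where x^~ is in F_A. *)
Definition eta_fun x : kite_over AL L :=
  match boolP (perfh x) with
  | AltTrue xF => inl (NegCone (eval_filt_le1 (FiltPart xF)))
  | AltFalse xJ =>
      inr (PosCone (eval_filt_inv_ge1 (FiltPart (radical_rneg xJ))))
  end.

Lemma eta_filt a : eta_fun (val a) = inl (NegCone (eval_filt_le1 a)).
Proof.
rewrite /eta_fun; case: {-}_ / boolP => [xF|xJ].
  2: by exfalso; move: xJ; rewrite filtP.
by congr inl; apply: val_inj => /=; congr eval_filt; apply: val_inj.
Qed.

Lemma eta_radical a :
  eta_fun (val a)^l- = inr (PosCone (eval_filt_inv_ge1 a)).
Proof.
rewrite /eta_fun; case: {-}_ / boolP => [xF|xJ].
  by exfalso; move: xF; rewrite perfh_lneg filtP.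
congr inr; apply: val_inj => /=; congr (eval_filt _)^-1; apply: val_inj => /=.
by rewrite lnegK.
Qed.

Variant filt_spec : A -> Type :=
| FiltSpec a : filt_spec (val a)
| RadicalSpec a : filt_spec (val a)^l-.

Lemma filt_specP x : filt_spec x.
Proof.
have [xF|xJ] := boolP (perfh x); first exact: (FiltSpec (FiltPart xF)).
by rewrite -[x]rnegK; apply: (RadicalSpec (FiltPart (radical_rneg xJ))).
Qed.

Lemma radical_le_filt a b : (val a)^l- <= val b.
Proof. by apply: perfh_le; rewrite ?perfh_lneg ?filtP. Qed.

Lemma filt_valI a b : val a `&` val b = val (a `&` b). Proof. by []. Qed.
Lemma filt_valU a b : val a `|` val b = val (a `|` b). Proof. by []. Qed.
Lemma filt_valM a b : val a * val b = val (a * b). Proof. by []. Qed.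
Lemma filt_valL a b : val a \ldiv val b = val (a \ldiv b). Proof. by []. Qed.
Lemma filt_valR a b : val a \rdiv val b = val (a \rdiv b). Proof. by []. Qed.

Lemma eval_filtI a b : eval_filt (a `&` b) = eval_filt a `&` eval_filt b.
Proof. by apply: funext => alpha; rewrite /eval_filt reslat_homI. Qed.
Lemma eval_filtU a b : eval_filt (a `|` b) = eval_filt a `|` eval_filt b.
Proof. by apply: funext => alpha; rewrite /eval_filt reslat_homU. Qed.
Lemma eval_filtM a b : eval_filt (a * b) = eval_filt a * eval_filt b.
Proof. by apply: funext => alpha; rewrite /eval_filt reslat_homM. Qed.
Lemma eval_filtL a b :
  eval_filt (a \ldiv b) = (eval_filt a)^-1 * eval_filt b `&` 1.
Proof. by apply: funext => alpha; rewrite /eval_filt reslat_homL. Qed.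
Lemma eval_filtR a b :
  eval_filt (a \rdiv b) = eval_filt a * (eval_filt b)^-1 `&` 1.
Proof. by apply: funext => alpha; rewrite /eval_filt reslat_homR. Qed.
Lemma eval_filt1 : eval_filt 1 = 1.
Proof. by apply: funext => alpha; rewrite /eval_filt reslat_hom1. Qed.

Lemma eta_homI : {morph eta_fun : x y / x `&` y}.
Proof.
move=> x y; case: (filt_specP x) => a; case: (filt_specP y) => b.
- rewrite filt_valI !eta_filt; congr inl; apply: val_inj.
  by rewrite /= eval_filtI.
- by rewrite meet_r ?radical_le_filt // eta_filt !eta_radical.
- by rewrite meet_l ?radical_le_filt // eta_filt !eta_radical.
- rewrite -lnegU filt_valU !eta_radical; congr inr; apply: val_inj.
  by rewrite /= eval_filtU invgU.
Qed.

Lemma eta_homU : {morph eta_fun : x y / x `|` y}.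
Proof.
move=> x y; case: (filt_specP x) => a; case: (filt_specP y) => b.
- rewrite filt_valU !eta_filt; congr inl; apply: val_inj.
  by rewrite /= eval_filtU.
- by rewrite join_l ?radical_le_filt // eta_radical !eta_filt.
- by rewrite join_r ?radical_le_filt // eta_radical !eta_filt.
- rewrite -lnegI filt_valI !eta_radical; congr inr; apply: val_inj.
  by rewrite /= eval_filtI invgI.
Qed.

Lemma shift_eval_filt a : shift (eval_filt a) = eval_filt (filt_rneg2 a).
Proof. by []. Qed.

Lemma eta_homM : {morph eta_fun : x y / x * y}.
Proof.
move=> x y; case: (filt_specP x) => a; case: (filt_specP y) => b.
- rewrite filt_valM !eta_filt; congr inl; apply: val_inj.
  by rewrite /= eval_filtM.
- have -> : val a * (val b)^l- = (val (b \rdiv filt_rneg2 a))^l-.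
    rewrite -[LHS]rnegK rnegM ldiv_rneg lnegK //.
  rewrite eta_filt !eta_radical; congr inr; apply: val_inj.
  by rewrite /= eval_filtR invgI invgF invg1 -shift_eval_filt.
- have -> : (val a)^l- * val b = (val (b \ldiv a))^l-.
    by rewrite -[LHS]rnegK rnegM lnegK.
  rewrite eta_filt !eta_radical; congr inr; apply: val_inj.
  by rewrite /= eval_filtL invgI invgM invgK invg1.
- have -> : (val a)^l- * (val b)^l- = (val (1 : filtpart A))^l-.
    rewrite lneg1; apply/le_anti; rewrite le0x andbT -le_ldiv.
    by rewrite -/(rneg _) lnegK radical_le_filt.
  rewrite !eta_radical; congr inr; apply: val_inj.
  by rewrite /= eval_filt1 invg1.
Qed.

Lemma eta_hom1 : eta_fun 1 = 1.
Proof.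
rewrite -[1]/(val (1 : filtpart A)) eta_filt; congr inl; apply: val_inj.
exact: eval_filt1.
Qed.

Lemma eta_hom_rneg : {morph eta_fun : x / x^r~}.
Proof.
move=> x; case: (filt_specP x) => a.
- rewrite -[(val a)^r~]rnegK.
  rewrite -[(val a)^r~^r~]/(val (filt_rneg2 a)) eta_filt eta_radical.
  congr inr; apply: val_inj.
  rewrite /= -shift_eval_filt mulg1 join_l //.
  exact: (eval_filt_inv_ge1 (filt_rneg2 a)).
- rewrite lnegK eta_filt eta_radical; congr inl; apply: val_inj.
  by rewrite /= invgK mulg1 meet_l // eval_filt_le1.
Qed.

Lemma eta_hom_lneg : {morph eta_fun : x / x^l-}.
Proof.
move=> x; case: (filt_specP x) => a.
- rewrite eta_filt eta_radical; congr inr; apply: val_inj.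
  by rewrite /= mul1g join_l // eval_filt_inv_ge1.
- rewrite -[(val a)^l-^l-]/(val (filt_lneg2 a)) eta_filt eta_radical.
  congr inl; apply: val_inj => /=.
  rewrite invgK mul1g.
  have -> : eval_filt a = shift_aut AL L (eval_filt (filt_lneg2 a)).
    by rewrite /= shift_eval_filt filt_lneg2K.
  by rewrite autK meet_l // eval_filt_le1.
Qed.

Definition eta : flw_hom A (kite_over AL L) :=
  pseudoMV_hom eta_homI eta_homU eta_homM eta_hom1 eta_hom_rneg eta_hom_lneg.

End Eta.

Section Epsilon.
Context (B : bcycle) d (L : lgroupType d).
Local Notation K := (kite_over B L).

(* F_K is exactly the left summand of K, so the second branch below is never
   taken. *)
Definition filt_coneE (a : filtpart K) : negcone (B -> L) :=
  match val a : K with inl x => x | inr _ => 1 end.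

Lemma filt_cone_le1 (a : filtpart K) (i : B) : val (filt_coneE a) i <= 1.
Proof. by have /lefP/(_ i) := negcone_le1 (filt_coneE a). Qed.

Definition proj_fun (i : B) (a : filtpart K) : negcone L :=
  NegCone (filt_cone_le1 a i).

Definition proj (i : B) : reslat_hom (filtpart K) (negcone L).
Proof.
by exists (proj_fun i) => [[[a|a] p] [[b|b] q]|[[a|a] p] [[b|b] q]
  |[[a|a] p] [[b|b] q]|[[a|a] p] [[b|b] q]|[[a|a] p] [[b|b] q]|] //;
  apply: val_inj.
Defined.

Lemma proj_twist (i : B) : proj (bcycle_fun i) = hom_twist (proj i).
Proof.
apply: reslat_hom_ext => -[[a|a] p] //; apply: val_inj => /=.
rewrite !mulg1 join_l.
  rewrite invgK meetfE [RHS]meet_l //.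
  exact: (lefP _ _ (negcone_le1 a)).
by rewrite le_invE invg1 (aut_le1 (shift_aut B L)) negcone_le1.
Qed.

Definition eps : bcycle_hom B (hom_cycle K L) :=
  @BCycleHom B (hom_cycle K L) proj proj_twist.

End Epsilon.

(* Main.v *)
Require Import Defs.
From mathcomp Require Import all_boot all_order.
From mathcomp Require Import boolp.

(** The statement is the universal property of [eta], that is, the adjunction
    between kites over B-cycles and homomorphisms of the filter part into L^-.
    The two assignments
      g : B -> [A,L]    |->  K_g o eta : A -> K_B(L),
      f : A -> K_B(L)   |->  [f,L] o eps : B -> [A,L]
    are mutually inverse, because both directions express the same currying:
    on the filter part, f is a map F_A -> (L^-)^B and g is a map B -> [A,L],
    and both correspondences read f(a)(i) = g(i)(a).

    That g |-> f |-> g is the identity ([hom_cycle_map_kite_map_eta]) only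
    involves values on F_A.  For f |-> g |-> f ([kite_map_eta_adjoint]) the
    values on the radical J_A are also needed; they are forced by those on F_A,
    since every element of J_A is a^- for some a in F_A and homomorphisms
    preserve negation ([flw_hom_eq_on_filt]).  Existence and uniqueness of g,
    and the formula for it, are then formal. *)

Set Implicit Arguments.
Unset Strict Implicit.
Unset Printing Implicit Defensive.

Local Open Scope group_scope.

Lemma bcycle_hom_ext (B C : bcycle) (g h : bcycle_hom B C) : g =1 h -> g = h.
Proof.
case: g h => [g gE] [h hE] /= /funext gh.
by subst g; congr BCycleHom; apply: Prop_irrelevance.
Qed.

Lemma hom_lneg d1 d2 (A1 : flwType d1) (A2 : flwType d2) (f : flw_hom A1 A2) x :
  f x^l- = (f x)^l-.
Proof. by rewrite /lneg (reslat_homR f) (flw_hom0 f). Qed.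

(** A perfect pseudo MV-algebra is generated by its filter part: the radical
    consists of the negations of the elements of the filter part. *)
Lemma flw_hom_eq_on_filt d1 d2 (A : perfectPMVType d1) (C : flwType d2)
    (f g : flw_hom A C) :
  (forall a : filtpart A, f (val a) = g (val a)) -> f = g.
Proof.
move=> fg; apply: flw_hom_ext => x.
by case: (filt_specP x) => a; rewrite ?hom_lneg fg.
Qed.

(** The second summand of a kite is its radical, so a homomorphism into a kite
    sends the filter part into the first summand. *)
Lemma kite_filt_map d d' (A : perfectPMVType d) (B : bcycle)
    (L : lgroupType d') (f : flw_hom A (kite_over B L)) (a : filtpart A) :
  f (val a) = inl (filt_coneE (filt_map f a)).
Proof.
rewrite /filt_coneE /=; have := filt_map_subproof f a.
by case: (f (val a)).
Qed.

Section Adjunction.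
Context (d d' : Order.disp_t) (A : perfectPMVType d) (B : bcycle).
Context (L : lgroupType d').

(** Evaluating K_g o eta at a in F_A and projecting to coordinate i yields
    (eta a)(g i) = g i a. *)
Lemma hom_cycle_map_kite_map_eta (g : bcycle_hom B (hom_cycle A L)) :
  bcycle_comp (hom_cycle_map L (flw_comp (kite_map L g) (eta A L))) (eps B L)
  = g.
Proof.
apply: bcycle_hom_ext => i; apply: reslat_hom_ext => a; apply: val_inj.
by rewrite /= /filt_coneE /= eta_filt.
Qed.

Lemma kite_map_eta_adjoint (f : flw_hom A (kite_over B L)) :
  flw_comp (kite_map L (bcycle_comp (hom_cycle_map L f) (eps B L))) (eta A L)
  = f.
Proof.
apply: flw_hom_eq_on_filt => a; rewrite [RHS]kite_filt_map /= eta_filt.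
by congr inl; apply: val_inj.
Qed.

End Adjunction.

Theorem corollary5 (d d' : Order.disp_t) (A : perfectPMVType d) (B : bcycle)
    (L : lgroupType d') (f : flw_hom A (kite_over B L)) :
  (exists! g : bcycle_hom B (hom_cycle A L),
      flw_comp (kite_map L g) (eta A L) = f) /\
  (forall g : bcycle_hom B (hom_cycle A L),
      flw_comp (kite_map L g) (eta A L) = f ->
      g = bcycle_comp (hom_cycle_map L f) (eps B L)).
Proof.
have formula (g : bcycle_hom B (hom_cycle A L)) :
    flw_comp (kite_map L g) (eta A L) = f ->
    g = bcycle_comp (hom_cycle_map L f) (eps B L).
  by move=> <-; rewrite hom_cycle_map_kite_map_eta.
split=> //; exists (bcycle_comp (hom_cycle_map L f) (eps B L)).
by split=> [|g /formula //]; apply: kite_map_eta_adjoint.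
Qed.
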